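(* Let $(R,\mathfrak{m},k)$ be a one-dimensional Noetherian local domain with integral closure $\overline{R}$ (in its fraction field) and fraction field $K$, and assume that the $\mathfrak{m}$-adic completion $\widehat{R}$ is reduced. For a non-zero ideal $J$ of $R$, consider the statements: (a) $h(J)=\lambda(R/J)$; (b) $R:_K J\subseteq \overline{R}$. Then (b) implies (a). Further, if $\overline{R}$ is a DVR, then (a) implies (b).
   Context: $\lambda(\cdot)$ denotes length as an $R$-module. $R:_KJ:=\{\alpha\in K\mid \alpha J\subseteq R\}$. Invariant $h$: for a finitely generated $R$-module $M$ of non-zero rank over a one-dimensional Noetherian local domain $R$, $h(M):=\min\{\lambda(R/I)\mid I=\phi(M)\text{ for some }R\text{-homomorphism }\phi:M\to R\}$ (the zero map contributes $\infty$). For a non-zero ideal $J$ this is $h(J)=\min\{\lambda(R/I)\mid I\text{ an ideal of }R,\ I\cong J\}$. *)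

(* Defs.v *)
From HB Require Import structures.
From mathcomp Require Import all_boot all_order all_algebra.
From mathcomp Require Import boolp functions.

Set Implicit Arguments.
Unset Strict Implicit.
Unset Printing Implicit Defensive.

Import GRing.Theory.
Local Open Scope ring_scope.
Local Open Scope quotient_scope.

(* Submodules and ideals are MathComp's boolean predicates.  Under the
   classical axioms of boolp every subset has such a characteristic function,
   so quantifying over [submodClosed V] is quantifying over all submodules.
   The ideals of a ring [A] are the submodules of the regular module [A^o],
   the unit ideal included. *)
Notation ideal A := (submodClosed (A^o)).

Definition proper_sub (T : Type) (A B : {pred T}) : Prop :=
  {subset A <= B} /\ ~ {subset B <= A}.

(* [None] stands for infinity. *)
Notation enat := (option nat).

(* The least n satisfying P, or infinity. *)
Definition least (P : nat -> Prop) : enat :=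
  match pselect (exists n, `[< P n >]) with
  | left exP => Some (ex_minn exP)
  | right _ => None
  end.

Lemma leastP (P : nat -> Prop) (n : nat) :
  least P = Some n <-> P n /\ forall k, P k -> (n <= k)%N.
Proof.
rewrite /least; case: pselect => [exP | noP]; last first.
  by split=> // -[Pn _]; case: noP; exists n; apply/asboolP.
case: ex_minnP => m /asboolP Pm m_min; split=> [[<-] | [Pn n_min]].
  by split=> // k Pk; apply: m_min; apply/asboolP.
congr Some; apply/eqP; rewrite eqn_leq n_min // andbT.
by apply: m_min; apply/asboolP.
Qed.

Definition enat_sup (P : nat -> Prop) : enat :=
  least (fun b => forall n, P n -> (n <= b)%N).

Definition submod_type (R : pzRingType) (V : lmodType R) (N : submodClosed V) :=
  {x : V | x \in N}.

HB.instance Definition _ (R : pzRingType) (V : lmodType R)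
  (N : submodClosed V) := SubChoice.on (submod_type N).
HB.instance Definition _ (R : pzRingType) (V : lmodType R)
  (N : submodClosed V) := [SubChoice_isSubLmodule of submod_type N by <:].

Section QuotientModule.
Variables (R : pzRingType) (V : lmodType R) (N : submodClosed V).

Definition submod_pred : {pred V} := N.
HB.instance Definition _ := GRing.isZmodClosed.Build V submod_pred
  (GRing.submod_closedB (submodClosedP N)).

Definition quotmod := Quotient.quot submod_pred.
HB.instance Definition _ := GRing.Zmodule.on quotmod.
HB.instance Definition _ := EqQuotient.on quotmod.

Lemma quotmod_eqP (x y : V) :
  reflect (\pi_quotmod x = \pi_quotmod y) (x - y \in N).
Proof.
by rewrite -[x - y \in N]/(x - y \in submod_pred) Quotient.idealrBE; apply: eqP.
Qed.

Definition quotmod_scale (a : R) (u : quotmod) : quotmod :=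
  \pi_quotmod (a *: repr u).

Lemma pi_scale (a : R) (x : V) :
  \pi_quotmod (a *: x) = quotmod_scale a (\pi_quotmod x).
Proof.
apply/quotmod_eqP; rewrite -scalerBr rpredZ //.
by apply/quotmod_eqP; rewrite reprK.
Qed.

Let scalerA a b u :
  quotmod_scale a (quotmod_scale b u) = quotmod_scale (a * b) u.
Proof.
elim/quotW: u => x.
by rewrite -(pi_scale b x) -(pi_scale a) -(pi_scale (a * b) x) scalerA.
Qed.

Let scale1r : left_id 1 quotmod_scale.
Proof. by elim/quotW=> x; rewrite -pi_scale scale1r. Qed.

Let scalerDr : right_distributive quotmod_scale +%R.
Proof.
move=> a; elim/quotW=> x; elim/quotW=> y.
rewrite -(pi_scale a x) -(pi_scale a y) -!(raddfD (\pi_quotmod)).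
by rewrite -(pi_scale a (x + y)) scalerDr.
Qed.

Let scalerDl u : {morph quotmod_scale^~ u : a b / a + b}.
Proof.
move=> a b; elim/quotW: u => x.
by rewrite -(pi_scale (a + b) x) -(pi_scale a x) -(pi_scale b x) scalerDl raddfD.
Qed.

HB.instance Definition _ :=
  GRing.Zmodule_isLmodule.Build R quotmod scalerA scale1r scalerDr scalerDl.
End QuotientModule.

Definition submod_chain (R : pzRingType) (V : lmodType R) (n : nat) : Prop :=
  exists c : nat -> submodClosed V,
    forall i, (i < n)%N -> proper_sub (c i) (c i.+1).

Definition mod_length (R : pzRingType) (V : lmodType R) : enat :=
  enat_sup (submod_chain V).

Section LinearImage.
Variables (R : pzRingType) (V W : lmodType R) (f : {linear V -> W}).

Definition lin_image : {pred W} := fun y => `[< exists x, f x = y >].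

Let lin_image_closed : GRing.subsemimod_closed lin_image.
Proof.
split; first split.
- by apply/asboolP; exists 0; rewrite linear0.
- move=> _ _ /asboolP[x <-] /asboolP[y <-].
  by apply/asboolP; exists (x + y); rewrite linearD.
- move=> a _ /asboolP[x <-].
  by apply/asboolP; exists (a *: x); rewrite linearZ.
Qed.
HB.instance Definition _ := GRing.isSubmodClosed.Build R W lin_image
  lin_image_closed.
End LinearImage.

(* The minimum of the lengths of R/phi(M); homomorphisms with a quotient of
   infinite length do not compete, and the value is [None] if all do so. *)
Definition h_inv (R : comPzRingType) (M : lmodType R) : enat :=
  least (fun n => exists phi : {linear M -> R^o},
    mod_length (quotmod (lin_image phi)) = Some n).

Definition reduced (A : pzRingType) : Prop :=
  forall (x : A) (n : nat), x ^+ n = 0 -> x = 0.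

Definition prime_ideal (A : comPzRingType) (P : ideal A) : Prop :=
  (1 : A) \notin P /\
  forall x y : A, x * y \in P -> x \in P \/ y \in P.

Definition maximal_ideal (A : comPzRingType) (I : ideal A) : Prop :=
  (1 : A) \notin I /\
  forall J : ideal A, {subset I <= J} -> (1 : A) \notin J -> {subset J <= I}.

Definition local_ring (A : comPzRingType) (m : ideal A) : Prop :=
  maximal_ideal m /\ forall I : ideal A, maximal_ideal I -> I =i m.

Definition noetherian (A : comPzRingType) : Prop :=
  forall I : ideal A, exists s : seq A, forall x : A,
    x \in I <-> exists c : nat -> A, x = \sum_(i < size s) c i * s`_i.

Definition krull_dim (A : comPzRingType) : enat :=
  enat_sup (fun n => exists P : nat -> ideal A,
    (forall i, (i <= n)%N -> prime_ideal (P i)) /\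
    (forall i, (i < n)%N -> proper_sub (P i) (P i.+1))).

Definition dvr (A : comNzRingType) : Prop :=
  [/\ forall x y : A, x * y = 0 -> x = 0 \/ y = 0,
      forall I : ideal A, exists a : A, forall x : A,
        x \in I <-> exists r : A, x = r * a &
      exists m : ideal A, local_ring m /\ exists2 x : A, x \in m & x != 0].

Section QuotientRing.
Variables (A : comPzRingType) (I : ideal A).

Definition quotring := quotmod I.
HB.instance Definition _ := GRing.Zmodule.on quotring.
HB.instance Definition _ := EqQuotient.on quotring.

Definition quotring_mul (u v : quotring) : quotring :=
  \pi_quotring ((repr u : A) * (repr v : A)).

Lemma quotring_piM (x y : A) :
  \pi_quotring (x * y) = quotring_mul (\pi_quotring x) (\pi_quotring y).
Proof.
apply/quotmod_eqP.
set x' := repr (\pi_quotring x); set y' := repr (\pi_quotring y).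
have Ix : (x - x' : A^o) \in I by apply/quotmod_eqP; rewrite reprK.
have Iy : (y - y' : A^o) \in I by apply/quotmod_eqP; rewrite reprK.
have -> : x * y - (x' : A) * (y' : A)
          = (y : A) *: (x - x' : A^o) + (x' : A) *: (y - y' : A^o) :> A^o.
  rewrite /GRing.scale /= !mulrBr [y * x]mulrC [y * x']mulrC.
  by rewrite addrA subrK.
by apply: rpredD; apply: rpredZ.
Qed.

Let quotring_mulA : associative quotring_mul.
Proof.
elim/quotW=> x; elim/quotW=> y; elim/quotW=> z.
by rewrite -(quotring_piM y z) -(quotring_piM x y) -(quotring_piM x (y * z))
  -(quotring_piM (x * y) z) mulrA.
Qed.

Let quotring_mulC : commutative quotring_mul.
Proof. by move=> u v; rewrite /quotring_mul mulrC. Qed.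

Let quotring_mul1 : left_id (\pi_quotring (1 : A)) quotring_mul.
Proof. by elim/quotW=> x; rewrite -(quotring_piM 1 x) mul1r. Qed.

Let quotring_mulDl : left_distributive quotring_mul +%R.
Proof.
elim/quotW=> x; elim/quotW=> y; elim/quotW=> z.
rewrite -(raddfD \pi_(quotmod I)) -(quotring_piM x z) -(quotring_piM y z).
by rewrite -(raddfD \pi_(quotmod I)) -(quotring_piM (x + y) z) mulrDl.
Qed.

HB.instance Definition _ := GRing.Zmodule_isComPzRing.Build quotring
  quotring_mulA quotring_mulC quotring_mul1 quotring_mulDl.
End QuotientRing.

Section IdealPower.
Variable A : comPzRingType.

Definition unit_ideal : {pred A^o} := predT.
Let unit_ideal_closed : GRing.subsemimod_closed unit_ideal.
Proof. by []. Qed.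
HB.instance Definition _ :=
  GRing.isSubmodClosed.Build A A^o unit_ideal unit_ideal_closed.

Definition ideal_mul (I J : ideal A) : {pred A^o} := fun x =>
  `[< exists2 s : seq (A * A),
        all (fun p => (p.1 \in I) && (p.2 \in J)) s &
        x = \sum_(p <- s) p.1 * p.2 >].

Let ideal_mul_closed I J : GRing.subsemimod_closed (ideal_mul I J).
Proof.
split; first split.
- by apply/asboolP; exists [::]; rewrite ?big_nil.
- move=> _ _ /asboolP[s hs ->] /asboolP[t ht ->]; apply/asboolP.
  by exists (s ++ t); rewrite ?all_cat ?hs ?big_cat.
- move=> a _ /asboolP[s hs ->]; apply/asboolP.
  exists [seq (a * p.1, p.2) | p <- s].
    rewrite all_map; apply: sub_all hs => p /= /andP[p1I ->].
    by rewrite andbT; apply: (rpredZ a).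
  rewrite big_map /GRing.scale /= mulr_sumr.
  by apply: eq_bigr => p _; rewrite mulrA.
Qed.
HB.instance Definition _ I J :=
  GRing.isSubmodClosed.Build A A^o (ideal_mul I J) (ideal_mul_closed I J).

Definition ideal_exp (I : ideal A) (n : nat) : ideal A :=
  iter n (fun J : ideal A => ideal_mul I J : ideal A) (unit_ideal : ideal A).
End IdealPower.

(* The completion is realized as the ring of Cauchy sequences modulo the ideal
   of null sequences, for the topology whose neighbourhoods of 0 are the powers
   of the ideal. *)
Section Completion.
Variables (A : comPzRingType) (I : ideal A).

Definition adic_cauchy : {pred nat -> A} := fun x =>
  `[< forall k, exists N, forall i j, (N <= i)%N -> (N <= j)%N ->
        x i - x j \in ideal_exp I k >].

Definition adic_null_seq (x : nat -> A) : Prop :=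
  forall k, exists N, forall i, (N <= i)%N -> x i \in ideal_exp I k.

Let adic_cauchy_closed : GRing.subring_closed adic_cauchy.
Proof.
split.
- by apply/asboolP => k; exists 0%N => i j _ _; rewrite subrr; apply: rpred0.
- move=> x y /asboolP hx /asboolP hy; apply/asboolP => k.
  have [N hN] := hx k; have [M hM] := hy k.
  exists (maxn N M) => i j; rewrite !geq_max => /andP[Ni Mi] /andP[Nj Mj].
  have -> : (x - y) i - (x - y) j = (x i - x j) - (y i - y j).
    by rewrite /= !opprD !opprK -!addrA; congr (_ + _); rewrite addrCA.
  apply: (GRing.submod_closedB (submodClosedP (ideal_exp I k))).2.
    exact: hN.
  exact: hM.
- move=> x y /asboolP hx /asboolP hy; apply/asboolP => k.
  have [N hN] := hx k; have [M hM] := hy k.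
  exists (maxn N M) => i j; rewrite !geq_max => /andP[Ni Mi] /andP[Nj Mj].
  have -> : (x * y) i - (x * y) j
            = (y i : A) *: (x i - x j : A^o) + (x j : A) *: (y i - y j : A^o).
    rewrite /GRing.scale /= !mulrBr [y i * x i]mulrC [y i * x j]mulrC.
    by rewrite addrA subrK.
  by apply: rpredD; apply: rpredZ; [exact: hN | exact: hM].
Qed.
HB.instance Definition _ :=
  GRing.isSubringClosed.Build (nat -> A) adic_cauchy adic_cauchy_closed.

Definition cauchy_seq := {x : nat -> A | x \in adic_cauchy}.
HB.instance Definition _ := SubChoice.on cauchy_seq.
HB.instance Definition _ := GRing.SubChoice_isSubComPzRing.Build
  _ _ cauchy_seq (subringClosedP _).

Definition null_ideal : {pred cauchy_seq^o} := fun x =>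
  `[< adic_null_seq (val (x : cauchy_seq)) >].

Let null_ideal_closed : GRing.subsemimod_closed null_ideal.
Proof.
split; first split.
- by apply/asboolP => k; exists 0%N => i _; apply: rpred0.
- move=> x y /asboolP hx /asboolP hy; apply/asboolP => k.
  have [N hN] := hx k; have [M hM] := hy k.
  exists (maxn N M) => i; rewrite geq_max => /andP[Ni Mi].
  by apply: rpredD; [exact: hN | exact: hM].
- move=> a x /asboolP hx; apply/asboolP => k.
  have [N hN] := hx k; exists N => i Ni.
  by apply: (rpredZ (val a i)); exact: hN.
Qed.
HB.instance Definition _ :=
  GRing.isSubmodClosed.Build cauchy_seq cauchy_seq^o null_ideal
    null_ideal_closed.

Definition adic_completion := quotring null_ideal.
HB.instance Definition _ := GRing.ComPzRing.on adic_completion.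
End Completion.

Section IntegralClosure.
Variable R : idomainType.

Definition integral_closure_pred : {pred {fraction R}} := fun x =>
  `[< integralOver (@FracField.tofrac R) x >].

Let integral_closure_closed : GRing.subring_closed integral_closure_pred.
Proof.
split.
- by apply/asboolP; exact: integral1.
- by move=> x y /asboolP hx /asboolP hy; apply/asboolP; exact: integral_sub.
- by move=> x y /asboolP hx /asboolP hy; apply/asboolP; exact: integral_mul.
Qed.
HB.instance Definition _ := GRing.isSubringClosed.Build {fraction R}
  integral_closure_pred integral_closure_closed.

Definition integral_closure := {x : {fraction R} | x \in integral_closure_pred}.
HB.instance Definition _ := SubChoice.on integral_closure.
HB.instance Definition _ := [SubChoice_isSubComNzRing of integral_closure by <:].

(* The fractional ideal (R :_K J), with K the fraction field. *)
Definition colon (J : ideal R) : {pred {fraction R}} := fun alpha =>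
  `[< forall x : R, x \in J -> exists r : R,
        alpha * FracField.tofrac x = FracField.tofrac r >].
End IntegralClosure.
Arguments integral_closure_pred R : clear implicits.

(* Main.v *)
From HB Require Import structures.
From mathcomp Require Import all_boot all_order all_algebra.
From mathcomp Require Import boolp.
Require Import Defs.

Set Implicit Arguments.
Unset Strict Implicit.
Unset Printing Implicit Defensive.

Import GRing.Theory.
Local Open Scope ring_scope.
Local Open Scope quotient_scope.

(** Fix a nonzero [z] in [J].  A homomorphism [phi : J -> R] satisfies
    [z * phi x = phi z * x], so it is multiplication by the fraction
    [alpha = phi z / z], an element of the colon [R :_K J]; conversely each
    element of the colon is a homomorphism.  Write [l] for length and put
    [d (a / b) = l (R/aR) - l (R/bR)].  If [I' = (a/b) I], that is
    [a I = b I'], then computing the colength of this ideal in two ways gives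
    [l (R/I') = l (R/I) + d (a / b)] (lemma [length_exchange]), whatever the
    ideal [I].  So statement (a) says exactly that [d alpha >= 0] for every
    nonzero [alpha] in the colon, and it is enough to relate the sign of [d] to
    integrality.

    The freedom in the choice of [I] does this.  A fraction [alpha] is integral
    over [R] if and only if [alpha I <= I] for some nonzero ideal [I]: when
    [alpha] is integral, the conductor of [R[alpha]] into [R] is such an ideal
    ([integral_stable_ideal]), and the converse is the determinant trick
    ([stable_ideal_integral]).  For such an [I], [alpha I <= I] forces
    [d alpha >= 0] if [alpha] is nonzero, which gives (b) -> (a).  Moreover
    [d alpha = 0] forces [alpha I = I], and then [1 / alpha] is integral too.

    For (a) -> (b), let [alpha] be in the colon and not integral.  The integral
    closure is a valuation ring ([dvr_valuation]), so [1 / alpha] is integral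
    and, its inverse not being integral, [d (1 / alpha) > 0].  Hence
    [d alpha < 0] and [alpha J] has smaller colength than [J].

    What makes the counting legitimate is that nonzero ideals have finite
    colength ([colength_exists]), because [R] is Noetherian of dimension one,
    and that length is additive, which the modular law gives directly
    for lengths defined by chains ([chain_split]). *)

(** * Submodules *)

Section Submodules.
Variables (R : pzRingType) (V : lmodType R).

(** Classically every [Prop]-valued submodule has a characteristic function. *)
Lemma submod_of_Prop (P : V -> Prop) :
    P 0 -> (forall x y, P x -> P y -> P (x + y)) ->
    (forall a x, P x -> P (a *: x)) ->
  exists U : submodClosed V, forall x, x \in U <-> P x.
Proof.
move=> P0 PD PZ; pose p : {pred V} := fun x => `[< P x >].
have p_closed : GRing.subsemimod_closed p.
  split; first split.
  - exact/asboolP.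
  - by move=> x y /asboolP Px /asboolP Py; apply/asboolP; exact: PD.
  - by move=> a x /asboolP Px; apply/asboolP; exact: PZ.
pose U : submodClosed V :=
  HB.pack p (GRing.isSubmodClosed.Build R V p p_closed).
by exists U => x; split=> /asboolP.
Qed.

Lemma submodB (A : submodClosed V) x y : x \in A -> y \in A -> x - y \in A.
Proof. exact: (GRing.submod_closedB (submodClosedP A)).2. Qed.

Definition zero_submod : {pred V} := pred1 0.
Let zero_closed : GRing.subsemimod_closed zero_submod.
Proof.
split; first split; rewrite /zero_submod ?inE //.
- by move=> x y; rewrite !inE => /eqP-> /eqP->; rewrite addr0.
- by move=> a x; rewrite !inE => /eqP->; rewrite scaler0.
Qed.
HB.instance Definition _ :=
  GRing.isSubmodClosed.Build R V zero_submod zero_closed.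

Definition full_submod : {pred V} := predT.
Let full_closed : GRing.subsemimod_closed full_submod.
Proof. by []. Qed.
HB.instance Definition _ :=
  GRing.isSubmodClosed.Build R V full_submod full_closed.

Definition submod_cap (A B : submodClosed V) : {pred V} :=
  fun x => (x \in A) && (x \in B).
Let cap_closed A B : GRing.subsemimod_closed (submod_cap A B).
Proof.
split; first split.
- by apply/andP; rewrite !rpred0.
- by move=> x y /andP[Ax Bx] /andP[Ay By]; apply/andP; rewrite !rpredD.
- by move=> a x /andP[Ax Bx]; apply/andP; rewrite !rpredZ.
Qed.
HB.instance Definition _ A B :=
  GRing.isSubmodClosed.Build R V (submod_cap A B) (cap_closed A B).

Definition submod_sum (A B : submodClosed V) : {pred V} :=
  fun x => `[< exists2 y, y \in A & x - y \in B >].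
Let sum_closed A B : GRing.subsemimod_closed (submod_sum A B).
Proof.
split; first split.
- by apply/asboolP; exists 0; rewrite ?subr0 rpred0.
- move=> x y /asboolP[x' Ax Bx] /asboolP[y' Ay By]; apply/asboolP.
  exists (x' + y'); first exact: rpredD.
  by rewrite opprD addrACA; apply: rpredD.
- move=> a x /asboolP[x' Ax Bx]; apply/asboolP.
  by exists (a *: x'); rewrite -?scalerBr rpredZ.
Qed.
HB.instance Definition _ A B :=
  GRing.isSubmodClosed.Build R V (submod_sum A B) (sum_closed A B).

Lemma submod_suml (A B : submodClosed V) : {subset A <= submod_sum A B}.
Proof. by move=> x Ax; apply/asboolP; exists x; rewrite ?subrr ?rpred0. Qed.

Lemma submod_sumr (A B : submodClosed V) : {subset B <= submod_sum A B}.
Proof. by move=> x Ax; apply/asboolP; exists 0; rewrite ?subr0 ?rpred0. Qed.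

Lemma submod_sum_sub (A B C : submodClosed V) :
  {subset A <= C} -> {subset B <= C} -> {subset submod_sum A B <= C}.
Proof.
move=> sAC sBC x /asboolP[y Ay By]; rewrite -(subrK y x).
by apply: rpredD; [apply: sBC | apply: sAC].
Qed.

End Submodules.
Arguments zero_submod {R} V.
Arguments full_submod {R} V.

Section LinearMaps.
Variables (R : pzRingType) (V W : lmodType R) (f : {linear V -> W}).

Definition submod_preim (B : submodClosed W) : {pred V} := fun x => f x \in B.
Let preim_closed B : GRing.subsemimod_closed (submod_preim B).
Proof.
split; first split.
- by have: f 0 \in B by rewrite linear0 rpred0.
- move=> x y Bx By.
  by have: f (x + y) \in B by rewrite linearD; apply: rpredD.
- move=> a x Bx.
  by have: f (a *: x) \in B by rewrite linearZ; apply: rpredZ.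
Qed.
HB.instance Definition _ B :=
  GRing.isSubmodClosed.Build R V (submod_preim B) (preim_closed B).

Definition submod_image (A : submodClosed V) : {pred W} :=
  fun y => `[< exists2 x, x \in A & f x = y >].
Let image_closed A : GRing.subsemimod_closed (submod_image A).
Proof.
split; first split.
- by apply/asboolP; exists 0; rewrite ?linear0 ?rpred0.
- move=> _ _ /asboolP[x Ax <-] /asboolP[y Ay <-]; apply/asboolP.
  by exists (x + y); rewrite ?linearD ?rpredD.
- move=> a _ /asboolP[x Ax <-]; apply/asboolP.
  by exists (a *: x); rewrite ?linearZ ?rpredZ.
Qed.
HB.instance Definition _ A :=
  GRing.isSubmodClosed.Build R W (submod_image A) (image_closed A).

End LinearMaps.

(** * Chains and relative length *)

Section Chains.
Variables (R : pzRingType) (V : lmodType R).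
Implicit Types A B C D : submodClosed V.

(** The chain of length 0 only asks for an inclusion, so the bottom and the top
    of a chain can be moved outwards ([chainW]) without counting a step. *)
Fixpoint chain A B (n : nat) : Prop :=
  if n is k.+1 then exists2 C, chain A C k & proper_sub C B
  else {subset A <= B}.

Lemma chain_sub A B n : chain A B n -> {subset A <= B}.
Proof.
elim: n B => [|n IHn] B //= [C /IHn sAC [CB _]] x Ax.
exact/CB/sAC.
Qed.

Lemma proper_sub_trans A B C :
  proper_sub A B -> {subset B <= C} -> proper_sub A C.
Proof.
move=> [AB nBA] BC; split=> [x /AB/BC // | CA].
by apply: nBA => x /BC/CA.
Qed.

Lemma chainW A A' B B' n :
  {subset A' <= A} -> {subset B <= B'} -> chain A B n -> chain A' B' n.
Proof.
move=> A'A; elim: n B B' => [|n IHn] B B' BB' /=.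
  by move=> AB x /A'A/AB/BB'.
move=> [C cC CB]; exists C; first exact: (IHn C).
exact: proper_sub_trans CB BB'.
Qed.

Lemma chain_cat A B C p q : chain A B p -> chain B C q -> chain A C (p + q).
Proof.
move=> AB; elim: q C => [|q IHq] C; rewrite ?addn0 ?addnS /=.
  by move=> BC; apply: chainW AB.
by move=> [D BD DC]; exists D => //; apply: IHq.
Qed.

(** Intersect a chain with [B] and add [B] to it: by the modular law, a strict
    step [D < C] cannot become an equality on both sides. *)
Lemma chain_split A B C n : chain A C n -> exists p q,
  [/\ (n <= p + q)%N, chain (submod_cap A B) (submod_cap C B) p
    & chain (submod_sum A B) (submod_sum C B) q].
Proof.
have capS D D' : {subset D <= D'} ->
    {subset submod_cap D B <= submod_cap D' B}.
  by move=> DD' x /andP[Dx Bx]; apply/andP; rewrite DD'.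
have sumS D D' : {subset D <= D'} ->
    {subset submod_sum D B <= submod_sum D' B}.
  by move=> DD' x /asboolP[y /DD' Dy By]; apply/asboolP; exists y.
elim: n C => [|n IHn] C /=.
  by move=> sAC; exists 0%N, 0%N; split=> //=; [exact: capS | exact: sumS].
move=> [D /IHn[p [q [npq cap_p sum_q]]] [DC nCD]].
have [capCD | ncapCD] :=
  pselect {subset submod_cap C B <= submod_cap D B}; last first.
  exists p.+1, q; split=> //; last by apply: chainW sum_q => //; exact: sumS.
  by exists (submod_cap D B : submodClosed V) => //; split=> //; exact: capS.
(* No step in the intersections, so the step of the sums must be strict. *)
exists p, q.+1; rewrite addnS; split=> //.
  by apply: chainW cap_p => //; exact: capS.
exists (submod_sum D B : submodClosed V) => //; split; first exact: sumS.
move=> sumCD; apply: nCD => x Cx.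
have /sumCD/asboolP[y Dy Bxy] : x \in submod_sum C B by exact: submod_suml.
rewrite -(subrK y x); apply: rpredD => //.
have /capCD/andP[] : x - y \in submod_cap C B; last by [].
by apply/andP; split=> //; apply: submodB => //; apply: DC.
Qed.

Lemma chain_refine A B C n : {subset A <= B} -> {subset B <= C} ->
    chain A C n ->
  exists p q, [/\ (n <= p + q)%N, chain A B p & chain B C q].
Proof.
move=> AB BC /(@chain_split _ B)[p [q [npq cap_p sum_q]]].
exists p, q; split=> //.
  by apply: chainW cap_p => [x Ax | x /andP[]//]; apply/andP; rewrite AB.
apply: chainW sum_q; first exact: submod_sumr.
exact: submod_sum_sub.
Qed.

(** The length of [B/A], stated for an interval of submodules so that additivity
    needs no isomorphism theorem. *)
Definition rel_length A B n :=
  chain A B n /\ forall k, chain A B k -> (k <= n)%N.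

Lemma rel_length_inj A B n k :
  rel_length A B n -> rel_length A B k -> n = k.
Proof.
move=> [cn bn] [ck bk]; apply/eqP; rewrite eqn_leq.
by rewrite (bn k) // (bk n).
Qed.

Lemma rel_length_eq A A' B n : A =i A' ->
  rel_length A B n -> rel_length A' B n.
Proof.
move=> eqA [cn bn].
split=> [|k ck]; [move: cn | apply: bn; move: ck].
  by apply: chainW => // x; rewrite eqA.
by apply: chainW => // x; rewrite eqA.
Qed.

Lemma rel_lengthD A B C p q :
  rel_length A B p -> rel_length B C q -> rel_length A C (p + q).
Proof.
move=> [cp bp] [cq bq]; split; first exact: chain_cat cp cq.
move=> k /(chain_refine (chain_sub cp) (chain_sub cq))[p' [q' [le_k cp' cq']]].
by apply: leq_trans le_k (leq_add (bp _ cp') (bq _ cq')).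
Qed.

Lemma rel_length_exists A B b : {subset A <= B} ->
  (forall k, chain A B k -> (k <= b)%N) -> exists n, rel_length A B n.
Proof.
move=> AB bb.
have ex0 : exists n, `[< chain A B n >] by exists 0%N; apply/asboolP.
have ub n : `[< chain A B n >] -> (n <= b)%N by move/asboolP/bb.
case: (ex_maxnP ex0 ub) => n /asboolP cn nmax; exists n; split=> // k ck.
by apply: nmax; apply/asboolP.
Qed.

Lemma rel_lengthW A A' B n n' : {subset A' <= A} ->
  rel_length A B n -> rel_length A' B n' -> (n <= n')%N.
Proof. by move=> A'A [cn _] [_]; apply; apply: chainW cn. Qed.

Lemma rel_length_lt A A' B n n' : proper_sub A' A ->
  rel_length A B n -> rel_length A' B n' -> (n < n')%N.
Proof.
move=> A'A [cn _] [_]; apply; rewrite -add1n; apply: chain_cat cn.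
by exists A'.
Qed.

Lemma chain_fun A B n : chain A B n ->
  exists c : nat -> submodClosed V,
    c n = B /\ forall i, (i < n)%N -> proper_sub (c i) (c i.+1).
Proof.
elim: n B => [|n IHn] B /=; first by exists (fun=> B).
move=> [C /IHn[c [cn cP]] CB].
exists (fun i => if (i <= n)%N then c i else B); rewrite ltnn; split=> // i.
rewrite ltnS => le_in; rewrite le_in; case: ltnP => [lt_in | le_ni].
  exact: cP.
by rewrite (_ : i = n) ?cn //; apply/eqP; rewrite eqn_leq le_in.
Qed.

Lemma chain_submod_chain n :
  submod_chain V n <-> chain (zero_submod V) (full_submod V) n.
Proof.
split=> [[c cP] | ].
  have sub0 (A : submodClosed V) : {subset zero_submod V <= A}.
    by move=> x /eqP->; apply: rpred0.
  suff cn : chain (c 0%N) (c n) n by apply: chainW cn.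
  elim: n cP => [|n IHn] cP //=; exists (c n); last exact: cP.
  by apply: IHn => i lt_in; apply: cP; apply: ltnW.
by move/chain_fun=> [c [_ cP]]; exists c.
Qed.

Lemma mod_lengthP n : mod_length V = Some n <->
  rel_length (zero_submod V) (full_submod V) n.
Proof.
rewrite leastP; split=> [[ub min_n] | [cn bn]].
  split=> [|k]; last by rewrite -chain_submod_chain; apply: ub.
  case: n ub min_n => [|n] ub min_n; first by move=> ?.
  have [//|ncn] := pselect (chain (zero_submod V) (full_submod V) n.+1).
  suff: (n.+1 <= n)%N by rewrite ltnn.
  apply: min_n => k ck; rewrite -ltnS ltn_neqAle ub // andbT.
  by apply: contra_notN ncn => /eqP<-; apply/chain_submod_chain.
split=> [k | k ub]; first by rewrite chain_submod_chain; apply: bn.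
exact/ub/chain_submod_chain.
Qed.

End Chains.

(** * Transport of length along linear maps *)

Section ChainMaps.
Variables (R : pzRingType) (V W : lmodType R) (f : {linear V -> W}).

Lemma chain_image (A B : submodClosed V) n :
    (forall x, f x = 0 -> x \in A) ->
  chain A B n -> chain (submod_image f A) (submod_image f B) n.
Proof.
move=> kerA.
have imS (C D : submodClosed V) : {subset C <= D} ->
    {subset submod_image f C <= submod_image f D}.
  by move=> CD _ /asboolP[x /CD Dx <-]; apply/asboolP; exists x.
elim: n B => [|n IHn] B /=; first exact: imS.
move=> [C cC [CB nBC]]; exists (submod_image f C : submodClosed W).
  exact: IHn.
split; first exact: imS.
move=> imBC; apply: nBC => x Bx.
have /imBC/asboolP[y Cy fxy] : f x \in submod_image f B.
  by apply/asboolP; exists x.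
rewrite -(subrK y x) rpredD //; apply: (chain_sub cC); apply: kerA.
by rewrite linearB /= fxy subrr.
Qed.

Lemma chain_preim (A B : submodClosed W) n :
    (forall y, y \in B -> exists x, y - f x \in A) ->
  chain A B n -> chain (submod_preim f A) (submod_preim f B) n.
Proof.
have preS (C D : submodClosed W) : {subset C <= D} ->
    {subset submod_preim f C <= submod_preim f D}.
  by move=> CD x; apply: CD.
elim: n B => [|n IHn] B /= surj; first exact: preS.
move=> [C cC [CB nBC]]; exists (submod_preim f C : submodClosed V).
  by apply: IHn => // y /CB/surj.
split; first exact: preS.
move=> preBC; apply: nBC => y By; have [x Ayx] := surj y By.
have Cyx := chain_sub cC Ayx.
rewrite -(subrK (f x) y) rpredD //; apply: preBC.
rewrite [_ \in _]/(f x \in B) -(subKr y (f x)); apply: submodB => //.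
exact: CB.
Qed.

Lemma rel_length_image (A B : submodClosed V) n :
    (forall x, f x = 0 -> x \in A) -> rel_length A B n ->
  rel_length (submod_image f A) (submod_image f B) n.
Proof.
move=> kerA [cn bn]; split; first exact: chain_image.
move=> k ck; apply: bn.
have surj y : y \in submod_image f B ->
    exists x, y - f x \in submod_image f A.
  by move=> /asboolP[x Bx <-]; exists x; rewrite subrr rpred0.
apply: chainW (chain_preim surj ck) => x.
  by move=> Ax; apply/asboolP; exists x.
move=> /asboolP[y By fyx].
rewrite -(subrK y x) rpredD //; apply: (chain_sub cn); apply: kerA.
by rewrite linearB /= fyx subrr.
Qed.

End ChainMaps.

(** * Length of a quotient module *)

Section QuotientLength.
Variables (R : pzRingType) (V : lmodType R) (N : submodClosed V).

Definition quot_map (x : V) : quotmod N := \pi_(quotmod N) x.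
Let quot_map_zmod : zmod_morphism quot_map.
Proof. by move=> x y; rewrite /quot_map raddfB. Qed.
HB.instance Definition _ :=
  GRing.isZmodMorphism.Build V (quotmod N) quot_map quot_map_zmod.
Let quot_map_scalable : scalable quot_map.
Proof. by move=> a x; rewrite /quot_map pi_scale. Qed.
HB.instance Definition _ :=
  GRing.isScalable.Build R V (quotmod N) *:%R quot_map quot_map_scalable.

Lemma quot_map_eq0 x : quot_map x = 0 <-> x \in N.
Proof.
rewrite -[X in _ = X](raddf0 quot_map) -{2}(subr0 x).
by split=> [/quotmod_eqP | /quotmod_eqP].
Qed.

Lemma mod_length_quotP n :
  mod_length (quotmod N) = Some n <-> rel_length N (full_submod V) n.
Proof.
have surj y : exists x, y = quot_map x.
  by exists (repr y); rewrite /quot_map reprK.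
have NP x : x \in N <-> quot_map x \in zero_submod (quotmod N).
  rewrite -quot_map_eq0; split=> [-> | /eqP //]; exact: eqxx.
rewrite mod_lengthP; split=> [[cn bn] | NVn].
  split.
    apply: chainW (chain_preim (f := quot_map) _ cn) => // [x /NP // | y _].
    by have [x ->] := surj y; exists x; rewrite subrr rpred0.
  move=> k ck; apply: bn.
  apply: chainW (chain_image (f := quot_map) _ ck) => //.
    by move=> y /eqP->; apply: rpred0.
  by move=> x /quot_map_eq0.
have kerN x : quot_map x = 0 -> x \in N by move/quot_map_eq0.
have [cn bn] := rel_length_image kerN NVn; split.
  by apply: chainW cn => // y /eqP->; apply: rpred0.
move=> k ck; apply: bn; apply: chainW ck.
  by move=> _ /asboolP[x Nx <-]; apply/NP.
by move=> y _; have [x ->] := surj y; apply/asboolP; exists x.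
Qed.

End QuotientLength.
(** * Ideals of Noetherian rings *)

Section Ideals.
Variable A : comPzRingType.
Implicit Types (I J M : ideal A) (x y : A).

Lemma idealM I a x : x \in I -> a * x \in I.
Proof. exact: (rpredZ a). Qed.

Definition mul_by (a : A) (x : A^o) : A^o := a * x.
Let mul_by_zmod a : zmod_morphism (mul_by a).
Proof. by move=> x y; rewrite /mul_by mulrBr. Qed.
HB.instance Definition _ a :=
  GRing.isZmodMorphism.Build A^o A^o (mul_by a) (mul_by_zmod a).
Let mul_by_scalable a : scalable (mul_by a).
Proof. by move=> c x; apply: mulrCA. Qed.
HB.instance Definition _ a :=
  GRing.isScalable.Build A A^o A^o *:%R (mul_by a) (mul_by_scalable a).

Definition principal (a : A) : ideal A :=
  submod_image (mul_by a) (full_submod A^o).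

Lemma principalP a x : x \in principal a <-> exists r, x = a * r.
Proof.
split=> [/asboolP[r _ <-] | [r ->]]; first by exists r.
by apply/asboolP; exists r.
Qed.

Lemma sum_principalP I a x :
  x \in submod_sum I (principal a) <-> exists r, x - a * r \in I.
Proof.
split=> [/asboolP[y Iy /principalP[r xy]] | [r Ixr]].
  by exists r; rewrite -xy subKr.
apply/asboolP; exists (x - a * r) => //.
by apply/principalP; exists r; rewrite subKr.
Qed.

Lemma ideal1_full I : 1 \in I -> forall x, x \in I.
Proof. by move=> I1 x; rewrite -(mulr1 x) idealM. Qed.

Lemma generator_mem I (s : seq A) :
    (forall x, x \in I <-> exists c : nat -> A,
       x = \sum_(i < size s) c i * s`_i) ->
  forall i, (i < size s)%N -> s`_i \in I.
Proof.
move=> sP i lt_is; apply/sP; exists (fun j => (j == i)%:R).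
rewrite (bigD1 (Ordinal lt_is)) //= eqxx mul1r big1 ?addr0 // => j.
by rewrite -val_eqE /= => /negPf->; rewrite mul0r.
Qed.

(** Noetherian induction: a failing ideal would start an infinite strictly
    ascending chain of failing ideals, but the finitely many generators of the
    union already lie in one of its terms. *)
Lemma noetherian_ind (P : ideal A -> Prop) : noetherian A ->
  (forall I, (forall J, proper_sub I J -> P J) -> P I) -> forall I, P I.
Proof.
move=> Anoeth ind I0; apply: contrapT => nPI0.
have step (I : {I : ideal A | ~ P I}) :
    exists J : {J : ideal A | ~ P J}, proper_sub (sval I) (sval J).
  apply: contrapT => noJ; apply: (svalP I); apply: ind => J IJ.
  by apply: contrapT => nPJ; apply: noJ; exists (exist _ J nPJ).
have [next nextP] := choice step.
pose c n : ideal A := sval (iter n next (exist _ I0 nPI0)).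
have cS n : {subset c n <= c n.+1}.
  by have [] := nextP (iter n next (exist _ I0 nPI0)).
have c_mono i j : (i <= j)%N -> {subset c i <= c j}.
  move=> /subnK<-; elim: (j - i)%N => [|k IHk] x; first by [].
  by rewrite addSn => /IHk/cS.
have [U UP] : exists U : ideal A, forall x, x \in U <-> exists n, x \in c n.
  apply: submod_of_Prop.
  - by exists 0%N; apply: rpred0.
  - move=> x y [i xi] [j yj]; exists (maxn i j); apply: rpredD.
      by apply: c_mono xi; rewrite leq_maxl.
    by apply: c_mono yj; rewrite leq_maxr.
  - by move=> a x [i xi]; exists i; apply: rpredZ.
have [s sP] := Anoeth U.
have sU := generator_mem sP.
have [N sN] : exists N, forall i, (i < size s)%N -> s`_i \in c N.
  elim: (size s) sU => [|k IHk] sU; first by exists 0%N.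
  have [i lt_ik|N sN] := IHk; first by apply: sU; apply: ltnW.
  have /UP[N' sN'] := sU k (ltnSn k).
  exists (maxn N N') => i; rewrite ltnS leq_eqVlt => /orP[/eqP->|lt_ik].
    by apply: c_mono sN'; rewrite leq_maxr.
  by apply: c_mono (sN i lt_ik); rewrite leq_maxl.
have [_] := nextP (iter N next (exist _ I0 nPI0)); apply=> x cx.
have /sP[d ->] : x \in U by apply/UP; exists N.+1.
by apply: rpred_sum => i _; apply: idealM; apply: sN.
Qed.

Lemma exists_maximal_ideal I : noetherian A -> 1 \notin I ->
  exists2 M, maximal_ideal M & {subset I <= M}.
Proof.
move=> Anoeth; elim/(noetherian_ind): I => // I IHI nI1.
have [Imax | nImax] := pselect (maximal_ideal I); first by exists I.
have [J [IJ nJ1]] : exists J, proper_sub I J /\ 1 \notin J.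
  apply: contrapT => noJ; apply: nImax; split=> // J IJ nJ1 x Jx.
  apply: contrapT => nIx; apply: noJ; exists J; split=> //.
  by split=> // JI; apply/nIx/JI.
have [M Mmax JM] := IHI J IJ nJ1.
by exists M => // x Ix; apply/JM/IJ.1.
Qed.

Lemma maximal_prime M : maximal_ideal M -> prime_ideal M.
Proof.
move=> [nM1 Mmax]; split=> // x y Mxy.
have [Mx | nMx] := boolP (x \in M); [by left | right].
have MS := @submod_suml _ _ M (principal x).
have [M1 | nS1] := boolP (1 \in submod_sum M (principal x)); last first.
  case/negP: nMx; apply: Mmax MS nS1 _ _; apply/sum_principalP.
  by exists 1; rewrite mulr1 subrr; apply: rpred0.
have /sum_principalP[r Mr] := M1.
rewrite (_ : y = y * (1 - x * r) + r * (x * y)).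
  by apply: rpredD; apply: idealM.
by rewrite mulrBr mulr1 (mulrC y) (mulrC x r) -mulrA addrNK.
Qed.

Lemma local_unit M x : noetherian A -> local_ring M -> x \notin M ->
  exists y, x * y = 1.
Proof.
move=> Anoeth [_ Muniq] nMx.
have [/principalP[y ->] | nx1] := boolP (1 \in principal x); first by exists y.
have [M' /Muniq eqM xM'] := exists_maximal_ideal Anoeth nx1.
case/negP: nMx; rewrite -eqM; apply: xM'; apply/principalP.
by exists 1; rewrite mulr1.
Qed.

(** The bound on [(I + xA)/I] that comes from its isomorphism with
    [A/(I : x)]. *)
Lemma chain_full_colon I x n : chain I (submod_sum I (principal x)) n ->
  chain (submod_preim (mul_by x) I) (full_submod A^o) n.
Proof.
move=> cn; apply: chainW (chain_preim (f := mul_by x) _ cn) => // y.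
by move/sum_principalP.
Qed.

End Ideals.

(** * Colength in a one-dimensional domain *)

Section OneDimensionalDomain.
Variable R : idomainType.
Implicit Types (I J : ideal R) (a b x y : R).
Hypotheses (Rnoeth : noetherian R) (Rdim1 : krull_dim R = Some 1%N).

Definition nonzero I := exists2 x : R, x \in I & x != 0.

(** Otherwise [0 < I < M], with [M] maximal, is too long a chain of primes. *)
Lemma nonzero_prime_maximal I : nonzero I -> prime_ideal I -> maximal_ideal I.
Proof.
move=> [x0 Ix0 x0n0] Iprime; split; first by have [] := Iprime.
move=> J IJ nJ1; have [M Mmax JM] := exists_maximal_ideal Rnoeth nJ1.
apply: contrapT => nJI.
have [dim_le1 _] := (leastP _ 1%N).1 Rdim1.
suff: (2 <= 1)%N by []; apply: dim_le1.
exists (fun i => if i is i'.+1 then if i' is 0%N then I else M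
                 else zero_submod R^o : ideal R); split=> [] [|[|[|i]]] //= _.
- split=> [|x y /eqP/eqP]; first by apply/negP => /eqP/eqP; rewrite oner_eq0.
  by rewrite mulf_eq0 => /orP[]; [left | right].
- exact: maximal_prime.
- split=> [x /eqP-> | I0]; first exact: rpred0.
  by case/negP: x0n0; apply: I0.
- split=> [x /IJ/JM // | MI]; apply: nJI => x /JM/MI//.
Qed.

(** By Noetherian induction: a nonzero prime is maximal, and if [x * y] is in [I]
    with [x] and [y] outside, then [I + xR] and [I : x] are larger than [I] and
    [l (R/I) <= l (R/(I + xR)) + l (R/(I : x))]. *)
Lemma colength_exists I : nonzero I ->
  exists n, rel_length I (full_submod R^o) n.
Proof.
elim/(noetherian_ind): I => // I IHI Inz.
suff [l ll] : exists l, forall k, chain I (full_submod R^o) k -> (k <= l)%N.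
  exact: rel_length_exists ll.
have [I1 | nI1] := boolP ((1 : R) \in I).
  exists 0%N => -[|k] //= [C cC [_ []]] x _.
  exact/(chain_sub cC)/ideal1_full.
have nz_sup J : {subset I <= J} -> nonzero J.
  by have [x Ix xn0] := Inz => IJ; exists x; first exact: IJ.
have [Iprime | nIprime] := pselect (prime_ideal I).
  have [_ Imax] := nonzero_prime_maximal Inz Iprime.
  exists 1%N => -[|[|k]] //= [C [D cD [DC nCD]] [_ nC]].
  case: nCD => x Cx; apply: (chain_sub cD); apply: Imax Cx.
    by move=> z /(chain_sub cD)/DC.
  by apply/negP => C1; apply: nC => z _; apply: ideal1_full.
have [x [y [Ixy nIx nIy]]] : exists x y : R,
    [/\ x * y \in I, x \notin I & y \notin I].
  apply: contrapT => noxy; apply: nIprime; split=> // x y Ixy.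
  have [Ix | nIx] := boolP (x \in I); [by left | right].
  by apply: contrapT => nIy; apply: noxy; exists x, y; split=> //; apply/negP.
have ISx : {subset I <= submod_sum I (principal x)} by exact: submod_suml.
have [|p [_ bp]] := IHI (submod_sum I (principal x)) _ (nz_sup _ ISx).
  split=> // /(_ x) Sx; case/negP: nIx; apply: Sx; apply/sum_principalP.
  by exists 1; rewrite mulr1 subrr; apply: rpred0.
have ICx : {subset I <= submod_preim (mul_by x) I}.
  by move=> z Iz; apply: idealM.
have [|q [_ bq]] := IHI (submod_preim (mul_by x) I) _ (nz_sup _ ICx).
  by split=> // /(_ y) Cy; case/negP: nIy; apply: Cy.
exists (q + p)%N => k ck.
have [//|k1 [k2 [le_k c1 c2]]] := chain_refine ISx _ ck.
apply: leq_trans le_k (leq_add (bq _ _) (bp _ c2)).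
exact: chain_full_colon.
Qed.

(** Multiplication by [a] identifies [R/I] with [aR/aI]. *)
Lemma rel_length_mul a I n p : a != 0 ->
    rel_length I (full_submod R^o) n ->
    rel_length (principal a) (full_submod R^o) p ->
  rel_length (submod_image (mul_by a) I) (full_submod R^o) (n + p).
Proof.
move=> a0 In; apply: rel_lengthD; apply: rel_length_image In => x /eqP.
by rewrite mulf_eq0 (negPf a0) => /eqP->; apply: rpred0.
Qed.

(** Here [I' = (a/b) I], and both sides are the colength of [aI = bI'].  Thus
    scaling by a fraction changes the colength of all ideals by the same
    amount. *)
Lemma length_exchange a b I I' n n' p q : a != 0 -> b != 0 ->
    submod_image (mul_by a) I =i submod_image (mul_by b) I' ->
    rel_length I (full_submod R^o) n -> rel_length I' (full_submod R^o) n' ->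
    rel_length (principal a) (full_submod R^o) p ->
    rel_length (principal b) (full_submod R^o) q ->
  (n + p = n' + q)%N.
Proof.
move=> a0 b0 eqI In In' ap bq.
apply: rel_length_inj (rel_length_mul a0 In ap) _.
apply: rel_length_eq (rel_length_mul b0 In' bq) => x.
by rewrite eqI.
Qed.

(** The inclusion [(a/b) I <= I'], without leaving [R]. *)
Definition scales_into a b I I' : Prop :=
  forall x, x \in I -> exists2 y, y \in I' & a * x = b * y.

(** The ideal [I'] is [(a/b) I], written as [{y | b y \in a I}]. *)
Lemma scaled_ideal a b I : b != 0 -> scales_into a b I I ->
  exists I', [/\ {subset I' <= I}, scales_into b a I' I
   & submod_image (mul_by a) I =i submod_image (mul_by b) I'].
Proof.
move=> b0 abI.
pose I' : ideal R := submod_preim (mul_by b) (submod_image (mul_by a) I).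
exists I'; split=> [y /asboolP[x Ix abxy] | y /asboolP[x Ix abxy] | z].
- have [x' Ix' abx] := abI x Ix.
  suff -> : y = x' by [].
  by apply: (mulfI b0); rewrite -abx; symmetry.
- by exists x => //; symmetry.
apply/asboolP/asboolP=> [[x Ix <-] | [y /asboolP[x Ix abxy] <-]].
  have [y Iy abxy] := abI x Ix; exists y; last by symmetry.
  by apply/asboolP; exists x.
by exists x.
Qed.

Local Notation "x %:F" := (@FracField.tofrac R x).
Local Notation integral := (integralOver (@FracField.tofrac R)).

(** * Integral fractions and stable ideals *)

(** The ideal is the conductor of [R[a/b]] into [R].  It contains [b ^ d], with
    [d] the degree of an integral equation: this clears the denominators of the
    powers below [d], and the equation expresses the higher ones through
    these. *)
Lemma integral_stable_ideal a b : b != 0 -> integral (a%:F / b%:F) ->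
  exists2 I, nonzero I & scales_into a b I I.
Proof.
move=> b0 [p pmonic /rootP p_root]; set alpha := a%:F / b%:F in p_root.
have bF0 : b%:F != 0 by rewrite tofrac_eq0.
have [I IP] : exists I : ideal R, forall x : R, x \in I <->
    forall k, exists r : R, x%:F * alpha ^+ k = r%:F.
  apply: submod_of_Prop => [k | x y xP yP k | c x xP k].
  - by exists 0; rewrite rmorph0 mul0r.
  - have [r rP] := xP k; have [s sP] := yP k.
    by exists (r + s); rewrite !rmorphD /= mulrDl rP sP.
  - have [r rP] := xP k; exists (c * r).
    by rewrite !rmorphM /= -mulrA rP.
exists I; last first.
  move=> x /IP xP; have [y yP] := xP 1%N; exists y.
    apply/IP => k; have [r rP] := xP k.+1.
    by exists r; rewrite -yP expr1 -mulrA -exprS.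
  apply/eqP; rewrite -tofrac_eq !rmorphM /= -yP expr1 /alpha.
  by rewrite mulrCA [b%:F * _]mulrC divfK // mulrC.
pose d := (size p).-1.
have size_p : size p = d.+1.
  by rewrite prednK // lt0n size_poly_eq0 monic_neq0.
have alpha_d : alpha ^+ d = - \sum_(i < d) (p`_i)%:F * alpha ^+ i.
  apply/eqP; rewrite -addr_eq0 addrC; apply/eqP; rewrite -[RHS]p_root.
  rewrite (@horner_coef_wide _ d.+1) ?size_map_poly_id0 ?size_p //; last first.
    by rewrite tofrac_eq0 lead_coef_eq0 monic_neq0.
  rewrite big_ord_recr /= coef_map /= -[p`_d]/(lead_coef p).
  rewrite (monicP pmonic) rmorph1 mul1r; congr (_ + _).
  by apply: eq_bigr => i _; rewrite coef_map.
(* The conductor is nonzero. *)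
exists (b ^+ d); last by rewrite expf_neq0.
apply/IP; elim/ltn_ind=> k IHk.
have [lt_kd | le_dk] := ltnP k d.
  exists (a ^+ k * b ^+ (d - k)).
  rewrite rmorphM !rmorphXn /= expr_div_n mulrCA; congr (_ * _).
  by rewrite -{1}(subnK (ltnW lt_kd)) exprD mulfK // expf_neq0.
have alpha_k : alpha ^+ k = - \sum_(i < d) (p`_i)%:F * alpha ^+ (k - d + i).
  rewrite -{1}(subnK le_dk) exprD alpha_d mulrN mulr_sumr; congr (- _).
  by apply: eq_bigr => i _; rewrite exprD mulrCA.
have /choice[r rP] : forall i : 'I_d, exists r : R,
    (b ^+ d)%:F * alpha ^+ (k - d + i) = r%:F.
  move=> i; apply: IHk; rewrite -{2}(subnK le_dk) ltn_add2l; exact: ltn_ord.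
exists (- \sum_(i < d) p`_i * r i).
rewrite alpha_k mulrN rmorphN rmorph_sum mulr_sumr; congr (- _).
by apply: eq_bigr => i _; rewrite rmorphM /= -rP mulrCA.
Qed.

(** The determinant trick: writing [(a/b) s_i] in terms of generators [s] of [I]
    makes [a/b] an eigenvalue of a matrix over [R], with eigenvector [s], and so
    a root of its monic characteristic polynomial. *)
Lemma stable_ideal_integral a b I : b != 0 -> nonzero I ->
  scales_into a b I I -> integral (a%:F / b%:F).
Proof.
move=> b0 [x0 Ix0 x0n0] abI; have [s sP] := Rnoeth I.
have bF0 : b%:F != 0 by rewrite tofrac_eq0.
have /choice[c cP] : forall i : 'I_(size s), exists c : nat -> R,
    a * s`_i = b * \sum_(j < size s) c j * s`_j.
  move=> i; have [y /sP[c ->]] := abI _ (generator_mem sP (ltn_ord i)).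
  by exists c.
pose M := \matrix_(j < size s, i < size s) c i j.
exists (char_poly M); first exact: char_poly_monic.
rewrite map_char_poly -eigenvalue_root_char; apply/eigenvalueP.
exists (\row_i (s`_i)%:F).
  apply/rowP=> i; rewrite !mxE -mulrAC -rmorphM cP rmorphM /=.
  rewrite [b%:F * _]mulrC mulfK // rmorph_sum; apply: eq_bigr => j _.
  by rewrite !mxE rmorphM mulrC.
apply: contra_neq x0n0 => /rowP s0; have /sP[d ->] := Ix0.
rewrite big1 // => i _; have := s0 i; rewrite !mxE => /eqP.
by rewrite tofrac_eq0 => /eqP->; rewrite mulr0.
Qed.

(** Since [(a/b) I <= I], scaling by [a/b] does not lower the colength of [I],
    and it raises it unless [(a/b) I = I]; by [length_exchange] the change is
    [p - q]. *)
Lemma stable_ideal_length a b I p q : a != 0 -> b != 0 ->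
    nonzero I -> scales_into a b I I ->
    rel_length (principal a) (full_submod R^o) p ->
    rel_length (principal b) (full_submod R^o) q ->
  (q <= p)%N /\ (~ scales_into b a I I -> (q < p)%N).
Proof.
move=> a0 b0 Inz abI ap bq.
have [I' [I'I baI eqI]] := scaled_ideal b0 abI.
have [n In] := colength_exists Inz.
have [x Ix xn0] := Inz.
have /colength_exists[n' In'] : nonzero I'.
  have /asboolP[y I'y bya] : a * x \in submod_image (mul_by b) I'.
    by rewrite -eqI; apply/asboolP; exists x.
  exists y => //; apply: contra_neq (mulf_neq0 a0 xn0) => y0.
  by rewrite -[LHS]bya y0 linear0.
have exch := length_exchange a0 b0 eqI In In' ap bq.
split=> [|nbaI].
  have le_n := rel_lengthW I'I In In'.
  by rewrite -(leq_add2l n') -exch leq_add2r.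
have lt_n : (n < n')%N.
  apply: rel_length_lt In In'; split=> // II'.
  by apply: nbaI => z /II'/baI.
by rewrite -(ltn_add2l n') -exch ltn_add2r.
Qed.

Lemma integral_length_le a b p q : a != 0 -> b != 0 ->
    integral (a%:F / b%:F) ->
    rel_length (principal a) (full_submod R^o) p ->
    rel_length (principal b) (full_submod R^o) q ->
  (q <= p)%N.
Proof.
move=> a0 b0 /(integral_stable_ideal b0)[I Inz abI] ap bq.
by have [] := stable_ideal_length a0 b0 Inz abI ap bq.
Qed.

(** Equality would make the stable ideal of [a/b] stable under [b/a] too, and
    [b/a] integral. *)
Lemma integral_length_lt a b p q : a != 0 -> b != 0 ->
    integral (a%:F / b%:F) -> ~ integral (b%:F / a%:F) ->
    rel_length (principal a) (full_submod R^o) p ->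
    rel_length (principal b) (full_submod R^o) q ->
  (q < p)%N.
Proof.
move=> a0 b0 /(integral_stable_ideal b0)[I Inz abI] nint ap bq.
have [_] := stable_ideal_length a0 b0 Inz abI ap bq; apply=> baI.
exact/nint/(stable_ideal_integral a0 Inz).
Qed.

End OneDimensionalDomain.

(** * The valuation property *)

Lemma fraction_split (R : idomainType) (alpha : {fraction R}) :
  exists a b : R, b != 0 /\
    alpha = FracField.tofrac a / FracField.tofrac b.
Proof.
elim/quotW: alpha => x; have x2 := denom_ratioP x.
exists (frac x).1, (frac x).2; split=> //.
apply: (canRL (mulfK _)); first by rewrite tofrac_eq0.
rewrite !piE; apply/eqmodP; rewrite /= FracField.equivfE.
by rewrite !numden_Ratio ?mulr1 ?oner_eq0 // mulrC.
Qed.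

(** For [alpha = a / b], let [g] generate the ideal [(a, b)] of the integral
    closure.  Then [a = x g] and [b = y g] with [(x, y)] the unit ideal, so by
    locality [x] or [y] is a unit. *)
Lemma dvr_valuation (R : idomainType) (alpha : {fraction R}) :
    dvr (integral_closure R) ->
  alpha \in integral_closure_pred R \/ alpha^-1 \in integral_closure_pred R.
Proof.
move=> [dom pid [M [Mlocal _]]].
have [a [b [b0 ->]]] := fraction_split alpha.
have icl_tofrac r : FracField.tofrac r \in integral_closure_pred R.
  by apply/asboolP; apply: integral_id.
pose incl r : integral_closure R :=
  exist (fun x => x \in integral_closure_pred R) _ (icl_tofrac r).
pose A := incl a; pose B := incl b.
have Onoeth : noetherian (integral_closure R).
  move=> I; have [g gP] := pid I; exists [:: g] => x; rewrite gP.
  split=> [[r ->] | [c ->]]; first by exists (fun=> r); rewrite big_ord1.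
  by exists (c 0%N); rewrite big_ord1.
have [g gP] := pid (submod_sum (principal A) (principal B)).
have /gP[x Ax] : A \in submod_sum (principal A) (principal B).
  by apply: submod_suml; apply/principalP; exists 1; rewrite mulr1.
have /gP[y By] : B \in submod_sum (principal A) (principal B).
  by apply: submod_sumr; apply/principalP; exists 1; rewrite mulr1.
have B0 : B != 0 by rewrite -val_eqE /= tofrac_eq0.
have /sum_principalP[v /principalP[u guv]] :
    g \in submod_sum (principal A) (principal B).
  by apply/gP; exists 1; rewrite mul1r.
have uv1 : u * x + v * y = 1.
  have /dom[] : g * (u * x + v * y - 1) = 0.
  - rewrite mulrBr mulr1 mulrDr ![g * (_ * _)]mulrCA ![g * _]mulrC -Ax -By.
    by rewrite [u * A]mulrC -guv [v * B]mulrC addrNK subrr.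
  - by move=> g0; move: B0; rewrite By g0 mulr0 eqxx.
  by move/eqP; rewrite subr_eq0 => /eqP.
have unit_case (z w : integral_closure R) : z * w = 1 ->
    val z != 0 /\ (val z)^-1 \in integral_closure_pred R.
  move=> /(congr1 val); rewrite rmorphM rmorph1 /= => zw1.
  have z0 : val z != 0.
    by apply: contra_eq_neq zw1 => ->; rewrite mul0r eq_sym oner_eq0.
  by split=> //; rewrite -[_^-1]mulr1 -zw1 mulKf //; apply: (valP w).
have aE : FracField.tofrac a = val x * val g by rewrite -rmorphM -Ax.
have bE : FracField.tofrac b = val y * val g by rewrite -rmorphM -By.
have g0 : val g != 0.
  by move: b0; rewrite -tofrac_eq0 bE mulf_eq0 negb_or => /andP[].
have -> : FracField.tofrac a / FracField.tofrac b = val x / val y.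
  by rewrite aE bE invfM mulrACA divff // mulr1.
have [Mx | nMx] := boolP (x \in M); last first.
  have [z /unit_case[x0 xV]] := local_unit Onoeth Mlocal nMx; right.
  by rewrite invf_div; apply: rpredM xV; apply: (valP y).
have [My | nMy] := boolP (y \in M); last first.
  have [z /unit_case[y0 yV]] := local_unit Onoeth Mlocal nMy; left.
  by apply: rpredM yV; apply: (valP x).
have [[/negP nM1 _] _] := Mlocal; case: nM1.
by rewrite -uv1; apply: rpredD; apply: idealM.
Qed.

(** * Homomorphisms from an ideal to the ring *)

(** Both sides are [phi (x * y)]; this is why a homomorphism from an ideal to the
    ring is multiplication by a fraction. *)
Lemma hom_cross_multiply (R : comPzRingType) (J : ideal R)
    (phi : {linear submod_type J -> R^o}) (x y : submod_type J) :
  (val x : R) * phi y = (val y : R) * phi x.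
Proof.
rewrite -[LHS]/((val x : R) *: phi y) -[RHS]/((val y : R) *: phi x) -!linearZ.
by congr (phi _); apply: val_inj; apply: mulrC.
Qed.

Section HomsOfIdeals.
Variables (R : idomainType) (J : ideal R).

Local Notation "x %:F" := (@FracField.tofrac R x).

Lemma hom_image_length (phi : {linear submod_type J -> R^o})
    (x0 : submod_type J)
    (n k p q : nat) : val x0 != 0 -> phi x0 != 0 ->
    rel_length J (full_submod R^o) n ->
    rel_length (lin_image phi) (full_submod R^o) k ->
    rel_length (principal (phi x0 : R)) (full_submod R^o) p ->
    rel_length (principal (val x0 : R)) (full_submod R^o) q ->
  (n + p = k + q)%N.
Proof.
move=> x00 phi0 Jn imk; apply: length_exchange Jn imk => // y.
apply/asboolP/asboolP=> [[x Jx <-] | [_ /asboolP[x <-] <-]].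
  exists (phi (exist (fun x => x \in J) _ Jx)); first by apply/asboolP; eexists.
  by rewrite [LHS](hom_cross_multiply phi x0) [LHS]mulrC.
exists (val x); first exact: (valP x).
by rewrite [LHS]mulrC [LHS](hom_cross_multiply phi x x0).
Qed.

Lemma colon_hom (alpha : {fraction R}) : alpha \in colon J ->
  exists phi : {linear submod_type J -> R^o},
    forall x, alpha * (val x)%:F = (phi x)%:F.
Proof.
move=> /asboolP colonJ.
have [f fP] : exists f : submod_type J -> R^o,
    forall x, alpha * (val x)%:F = (f x)%:F.
  have /choice[f fP] : forall x : submod_type J,
      exists r : R^o, alpha * (val x)%:F = r%:F.
    by move=> x; exact: colonJ (valP x).
  by exists f.
have f_zmod : zmod_morphism f.
  move=> x y; apply/eqP; rewrite -(@tofrac_eq R) [X in _ == X]tofracB -!fP.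
  by rewrite !rmorphB mulrBr.
have f_scal : scalable f.
  move=> a x; apply/eqP; rewrite -(@tofrac_eq R) [X in _ == X]tofracM -!fP.
  by rewrite mulrCA -rmorphM.
pose phi : {linear submod_type J -> R^o} :=
  HB.pack f (GRing.isZmodMorphism.Build _ _ f f_zmod)
    (GRing.isScalable.Build _ _ _ _ f f_scal).
by exists phi.
Qed.

(** As the inclusion of [J] is one of the competing homomorphisms, [h] is at most
    the colength of [J]. *)
Lemma colength_le_h n : rel_length J (full_submod R^o) n ->
  (forall k (phi : {linear submod_type J -> R^o}),
     rel_length (lin_image phi) (full_submod R^o) k -> (n <= k)%N) <->
  h_inv (submod_type J) = mod_length (quotmod J).
Proof.
move=> Jn; rewrite ((mod_length_quotP _ _).2 Jn) leastP.
split=> [min_n | [_ min_n] k phi imk]; last first.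
  by apply: min_n; exists phi; apply/mod_length_quotP.
split=> [|k [phi /mod_length_quotP/min_n //]].
exists (val : {linear submod_type J -> R^o}); apply/mod_length_quotP.
apply: rel_length_eq Jn => x; apply/idP/asboolP=> [Jx | [y <-]].
  by exists (exist (fun x => x \in J) _ Jx).
exact: (valP y).
Qed.

End HomsOfIdeals.

Theorem theorem2 (R : idomainType) (m : ideal R)
    (R_noetherian : noetherian R)
    (R_local : local_ring m)
    (R_dim1 : krull_dim R = Some 1%N)
    (R_analytically_unramified : reduced (adic_completion m))
    (J : ideal R) (J_neq0 : exists2 x : R, x \in J & x != 0) :
  let a := h_inv (submod_type J) = mod_length (quotmod J) in
  let b := {subset colon J <= integral_closure_pred R} in
  (b -> a) /\ (dvr (integral_closure R) -> a -> b).
Proof.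
move=> a b; have [n Jn] := colength_exists R_noetherian R_dim1 J_neq0.
have [z Jz z0] := J_neq0.
pose x0 : submod_type J := exist (fun x => x \in J) z Jz.
have zF0 : FracField.tofrac z != 0 by rewrite tofrac_eq0.
have principal_length (c : R) : c != 0 ->
    exists p, rel_length (principal c) (full_submod R^o) p.
  move=> c0; apply: colength_exists => //; exists c => //.
  by apply/principalP; exists 1; rewrite mulr1.
have [q zq] := principal_length z z0.
split=> [colonJ | Rdvr /(colength_le_h Jn) min_n].
  apply/(colength_le_h Jn) => k phi imk.
  have [phi0 | phi0] := eqVneq (phi x0) 0.
    (* The image of [phi] is then zero, hence contained in [J]. *)
    apply: rel_lengthW Jn imk => _ /asboolP[x <-].
    have /eqP := hom_cross_multiply phi x0 x.
    by rewrite phi0 mulr0 mulf_eq0 (negPf z0) => /eqP->; apply: rpred0.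
  have [p phip] := principal_length _ phi0.
  have len := hom_image_length (x0 := x0) z0 phi0 Jn imk phip zq.
  rewrite -(leq_add2r p) len leq_add2l.
  apply: (integral_length_le R_noetherian R_dim1 phi0 z0 _ phip zq).
  apply/asboolP; apply: colonJ; apply/asboolP => x Jx.
  exists (phi (exist (fun x => x \in J) x Jx)).
  apply: (mulfI zF0).
  rewrite mulrA mulrCA divff // mulr1 -!rmorphM; congr (FracField.tofrac _).
  rewrite mulrC; exact: (hom_cross_multiply phi (exist _ x Jx) x0).
move=> alpha alphaJ; apply: contrapT => alpha_nint.
have [phi phiP] := colon_hom alphaJ.
have alphaE : alpha = @FracField.tofrac R (phi x0) / FracField.tofrac z.
  by rewrite -phiP mulfK.
have phi0 : phi x0 != 0.
  apply: contra_not_neq alpha_nint => phi0.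
  by rewrite alphaE phi0 rmorph0 mul0r; apply: rpred0.
have [p phip] := principal_length _ phi0.
have alphaV_int : alpha^-1 \in integral_closure_pred R.
  case: (dvr_valuation alpha Rdvr) => [/alpha_nint[] | alphaV_int];
    exact: alphaV_int.
have lt_pq : (p < q)%N.
  apply: (integral_length_lt R_noetherian R_dim1 z0 phi0 _ _ zq phip).
    by apply/asboolP; rewrite -invf_div -alphaE.
  by rewrite -alphaE => alpha_int; apply: alpha_nint; apply/asboolP.
have [|k imk] := colength_exists R_noetherian R_dim1 (I := lin_image phi).
  by exists (phi x0); [apply/asboolP; exists x0 | exact: phi0].
have len := hom_image_length (x0 := x0) z0 phi0 Jn imk phip zq.
have := min_n k phi imk.
by rewrite -(leq_add2r p) len leq_add2l leqNgt lt_pq.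
Qed.
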